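(* Let $X$ be an $(e^*,\theta)^*$-normal topological space, $Y$ a topological space, and $f:X\to Y$ a surjection that is $(e^*,\theta)^*$-closed and strongly $e^*$-irresolute. Then $Y$ is $(e^*,\theta)^*$-normal.
   Context: For a subset $A$ of a topological space $X$, $cl(A)$ and $int(A)$ denote closure and interior. The $\delta$-closure $cl_\delta(A)$ is the set of points $x\in X$ such that $int(cl(U))\cap A\neq\emptyset$ for every open $U$ containing $x$. $A$ is $e^*$-open if $A\subseteq cl(int(cl_\delta(A)))$; complements of $e^*$-open sets are $e^*$-closed; $e^*\text{-}cl(A)$ is the intersection of all $e^*$-closed sets containing $A$. The $e^*$-$\theta$-closure $e^*\text{-}cl_\theta(A)$ is the set of points $x\in X$ such that $e^*\text{-}cl(U)\cap A\neq\emptyset$ for every $e^*$-open set $U$ containing $x$. $A$ is $e^*$-$\theta$-closed if $A=e^*\text{-}cl_\theta(A)$; complements of $e^*$-$\theta$-closed sets are called $e^*$-$\theta$-open. $A$ is $(e^*,\theta)$-closed if $e^*\text{-}cl_\theta(A)\subseteq U$ whenever $A\subseteq U$ and $U$ is $e^*$-$\theta$-open in $X$. A function $f:X\to Y$ is $(e^*,\theta)^*$-closed if the image of each $e^*$-$\theta$-closed set of $X$ is $(e^*,\theta)$-closed in $Y$. It is strongly $e^*$-irresolute if for each $x\in X$ and each $e^*$-open set $V$ of $Y$ containing $f(x)$ there exists an $e^*$-open set $U$ of $X$ containing $x$ such that $f[e^*\text{-}cl(U)]\subseteq V$. A space is $(e^*,\theta)^*$-normal if for any pair of disjoint $e^*$-$\theta$-closed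 sets $F_1$ and $F_2$ there exist disjoint $e^*$-$\theta$-open sets $U_1$ and $U_2$ with $F_1\subseteq U_1$ and $F_2\subseteq U_2$. *)

(* Defs.v *)
From mathcomp Require Import all_boot all_order.
From mathcomp Require Import boolp classical_sets functions.
From mathcomp Require Import topology.

Set Implicit Arguments.
Unset Strict Implicit.
Unset Printing Implicit Defensive.

Local Open Scope classical_set_scope.

Section EStar.
Context {X : topologicalType}.
Implicit Types A U V F : set X.

Definition delta_closure A : set X :=
  [set x | forall U, open U -> U x -> interior (closure U) `&` A !=set0].

Definition estar_open A : Prop :=
  A `<=` closure (interior (delta_closure A)).

Definition estar_closed A : Prop := estar_open (~` A).

Definition estar_closure A : set X :=
  \bigcap_(F in [set F | estar_closed F /\ A `<=` F]) F.

Definition estar_theta_closure A : set X :=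
  [set x | forall U, estar_open U -> U x -> estar_closure U `&` A !=set0].

Definition estar_theta_closed A : Prop := A = estar_theta_closure A.

Definition estar_theta_open A : Prop := estar_theta_closed (~` A).

(* "(e*,theta)-closed": a generalized-closed notion, not to be confused with
   "e*-theta-closed" above. *)
Definition estar_theta_gclosed A : Prop :=
  forall U, A `<=` U -> estar_theta_open U -> estar_theta_closure A `<=` U.

End EStar.

(* "(e*,theta)^*-closed" functions *)
Definition estar_theta_closed_map (X Y : topologicalType) (f : X -> Y) : Prop :=
  forall F : set X, estar_theta_closed F -> estar_theta_gclosed (f @` F).

Definition strongly_estar_irresolute (X Y : topologicalType) (f : X -> Y) : Prop :=
  forall (x : X) (V : set Y), estar_open V -> V (f x) ->
    exists U : set X, [/\ estar_open U, U x & f @` estar_closure U `<=` V].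

(* "(e*,theta)^*-normal" spaces *)
Definition estar_theta_normal (X : topologicalType) : Prop :=
  forall F1 F2 : set X, estar_theta_closed F1 -> estar_theta_closed F2 ->
    F1 `&` F2 = set0 ->
    exists U1 U2 : set X,
      [/\ estar_theta_open U1, estar_theta_open U2, U1 `&` U2 = set0,
          F1 `<=` U1 & F2 `<=` U2].

(* Main.v *)
(** The preimage of an e*-theta-closed set under [f] is e*-theta-closed, so a
    disjoint pair [F1, F2] in [Y] pulls back to [X] and is separated there by
    [U1, U2]. The complements of the e*-theta-closures of [f (X \ Ui)] separate
    [F1] and [F2]: they contain [Fi] because [f (X \ Ui)] is
    (e*,theta)-closed, and they are disjoint because [f] is onto. They are
    e*-theta-open because the e*-theta-closure is idempotent, which rests on
    the fact that the e*-closure of an e*-open set is again e*-open. *)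
Require Import Defs.
From mathcomp Require Import all_boot all_order.
From mathcomp Require Import boolp classical_sets functions.
From mathcomp Require Import topology.

Local Open Scope classical_set_scope.

Section EStarClosure.
Context {X : topologicalType}.
Implicit Types A B U : set X.

Lemma subset_delta_closure A : A `<=` delta_closure A.
Proof.
move=> x Ax U oU Ux; exists x; split=> //.
suff : U `<=` interior (closure U) by apply.
by rewrite -open_subsetE //; exact: subset_closure.
Qed.

Lemma delta_closureS A B : A `<=` B -> delta_closure A `<=` delta_closure B.
Proof.
move=> AB x Ax U oU Ux; have [y [Uy Ay]] := Ax U oU Ux.
by exists y; split=> //; exact: AB.
Qed.

Lemma open_estar_open A : open A -> estar_open A.
Proof.
move=> oA; apply: subset_trans (@subset_closure _ _).
by rewrite -open_subsetE //; exact: subset_delta_closure.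
Qed.

Lemma closed_estar_closed A : closed A -> estar_closed A.
Proof. by move=> cA; apply: open_estar_open; exact: closed_openC. Qed.

Lemma subset_estar_closure A : A `<=` estar_closure A.
Proof. by move=> x Ax F [_ AF]; exact: AF. Qed.

Lemma estar_closure_sub {A} F :
  estar_closed F -> A `<=` F -> estar_closure A `<=` F.
Proof. by move=> cF AF x; apply. Qed.

Lemma estar_closure_idem A :
  estar_closure (estar_closure A) `<=` estar_closure A.
Proof.
by move=> x Ax F [cF AF]; apply: Ax; split=> //; exact: estar_closure_sub.
Qed.

(* [closure (interior (delta_closure (estar_closure U)))] is closed, hence
   e*-closed, and contains [U], so it contains [estar_closure U]. *)
Lemma estar_open_closure U : estar_open U -> estar_open (estar_closure U).
Proof.
move=> oU; apply: estar_closure_sub.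
  by apply: closed_estar_closed; exact: closed_closure.
apply: (subset_trans oU); apply/closureS/interiorS/delta_closureS.
exact: subset_estar_closure.
Qed.

Lemma subset_estar_theta_closure A : A `<=` estar_theta_closure A.
Proof.
by move=> x Ax U _ Ux; exists x; split=> //; exact: subset_estar_closure.
Qed.

Lemma estar_theta_closed_closure A :
  estar_theta_closed (estar_theta_closure A).
Proof.
apply/seteqP; split; first exact: subset_estar_theta_closure.
move=> x Ax U oU Ux; have [y [Uy Ay]] := Ax U oU Ux.
(* [estar_closure U] is itself an e*-open set around [y], so [Ay] applies to it. *)
have [z [Uz Az]] := Ay _ (estar_open_closure _ oU) Uy.
by exists z; split=> //; exact: estar_closure_idem.
Qed.

End EStarClosure.

(** An e*-open [V] around [f x] gives an e*-open [U] around [x] with [f] mapping [estar_closure U]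
    into [V]; that closure meets the preimage of [F], so [V] meets [F]. *)
Lemma estar_theta_closed_preimage {X Y : topologicalType} (f : X -> Y)
    (F : set Y) :
  strongly_estar_irresolute f -> estar_theta_closed F ->
  estar_theta_closed (f @^-1` F).
Proof.
move=> irr_f cF; apply/seteqP; split; first exact: subset_estar_theta_closure.
move=> x Fx; rewrite /preimage /= cF => V oV Vfx.
have [U [oU Ux UV]] := irr_f x V oV Vfx.
have [z [Uz Fz]] := Fx U oU Ux.
exists (f z); split=> //.
by apply: subset_estar_closure; apply: UV; exists z.
Qed.

Lemma closed_map_separation {X Y : topologicalType} {f : X -> Y}
    (F : set Y) (U : set X) :
  estar_theta_closed_map f -> estar_theta_closed F -> estar_theta_open U ->
  f @^-1` F `<=` U -> F `<=` ~` estar_theta_closure (f @` (~` U)).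
Proof.
(* The image of the complement of [U] lies in the complement of [F], which is e*-theta-open and so
   also contains the e*-theta-closure of that image. *)
move=> closed_f cF oU FU; apply: subsetCr; apply: (closed_f _ oU).
  by move=> _ [x nUx <-] Ffx; exact/nUx/FU.
by rewrite /estar_theta_open setCK.
Qed.

Theorem theorem15 (X Y : topologicalType) (f : X -> Y)
  (normalX : estar_theta_normal X)
  (surj_f : set_surj [set: X] [set: Y] f)
  (closed_f : estar_theta_closed_map f)
  (irr_f : strongly_estar_irresolute f) :
  estar_theta_normal Y.
Proof.
move=> F1 F2 cF1 cF2 F12.
have [||| U1 [U2 [oU1 oU2 U12 FU1 FU2]]] :=
  normalX (f @^-1` F1) (f @^-1` F2).
- exact: estar_theta_closed_preimage.
- exact: estar_theta_closed_preimage.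
- by rewrite -preimage_setI F12 preimage_set0.
exists (~` estar_theta_closure (f @` (~` U1))),
  (~` estar_theta_closure (f @` (~` U2))); split.
- by rewrite /estar_theta_open setCK; exact: estar_theta_closed_closure.
- by rewrite /estar_theta_open setCK; exact: estar_theta_closed_closure.
- apply/seteqP; split=> // y [nV1y nV2y].
  (* If [x] were outside [U1] or [U2], then [y] would lie in the image of that complement. *)
  have [x _ fxy] := surj_f y I.
  suff : (U1 `&` U2) x by rewrite U12.
  split; apply: contrapT => nUx; [apply: nV1y | apply: nV2y];
    by apply: subset_estar_theta_closure; exists x.
- exact: closed_map_separation.
- exact: closed_map_separation.
Qed.
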